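(* Let $p$ be a prime, $\mathbb{F}_q$ a finite field of characteristic $p$, $n\ge1$, $s_1,\dots,s_n$ positive integers, and $m_1,\dots,m_n$ nonnegative integers. Let $$C=\langle (x_1-1)^{m_1}\cdots(x_n-1)^{m_n}\rangle\subset\mathcal{R}=\frac{\mathbb{F}_q[x_1,\dots,x_n]}{\langle x_1^{p^{s_1}}-1,\dots,x_n^{p^{s_n}}-1\rangle},$$ let $L=\{(i_1,\dots,i_n)\in\mathbb{N}^n: 0\le i_j<p^{s_j}\text{ for all }j\}$, and let $$Q=\bigcup_{\ell=1}^n\{(a_1,\dots,a_n)\in\mathbb{N}^n:\ 0\le a_\ell<m_\ell,\ 0\le a_j<p^{s_j}\text{ for } j\ne\ell\}.$$ For $\vec a=(a_1,\dots,a_n)\in Q$ let $w_{\vec a}\in\mathbb{F}_q^{L}$ be the vector whose entry at position $(i_1,\dots,i_n)\in L$ is (the image in $\mathbb{F}_q$ of) $\binom{i_1}{a_1}\cdots\binom{i_n}{a_n}$. Let $H$ be the matrix whose rows are the vectors $w_{\vec a}$, $\vec a\in Q$, with columns indexed by $L$. Then $H$ is a parity check matrix for $C$.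
   Context: $\mathbb{N}=\{0,1,2,\dots\}$, and $\binom{i}{a}=0$ whenever $i<a$. Each element of $\mathcal{R}$ is identified with its unique representative $g=\sum_{i\in L}g_i x_1^{i_1}\cdots x_n^{i_n}$ and hence with its coefficient vector $u_g=(g_i)_{i\in L}\in\mathbb{F}_q^L$. (The coordinates in $L$ are ordered by the lexicographic order with $x_1>\cdots>x_n$, from largest to smallest; the same order is used for the $w_{\vec a}$ and for the $u_g$.) ''$H$ is a parity check matrix for $C$'' means that, for $g\in\mathcal{R}$, one has $g\in C$ if and only if $H u_g^{T}=0$. *)

(* Defs.v *)
From HB Require Import structures.
From mathcomp Require Import all_boot all_order all_algebra.
From mathcomp Require Import generic_quotient ring_quotient.
From mathcomp Require Import boolp.
From mathcomp Require Import mpoly.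

Set Implicit Arguments.
Unset Strict Implicit.
Unset Printing Implicit Defensive.

Import GRing.Theory.
Local Open Scope ring_scope.
Local Open Scope quotient_scope.

(* The multi-indices (i_1, .., i_n) with 0 <= i_j < N j for all j. *)
Definition box n (N : 'I_n -> nat) := {dffun forall j : 'I_n, 'I_(N j)}.

(* Lexicographic comparison, coordinate 0 being the most significant one:    *)
(* lexge i i' means that i comes first when sorting from largest to smallest. *)
Definition lexge n (N : 'I_n -> nat) : rel (box N) := fun i i' =>
  (i == i') ||
  [exists j : 'I_n, (i' j < i j)%N
     && [forall k : 'I_n, (k < j)%N ==> (i k == i' k)]].

Definition lexbox n (N : 'I_n -> nat) : #|{: box N}|.-tuple (box N) :=
  [tuple of sort (@lexge n N) (enum_tuple {: box N})].

Definition ideal_gen (A : comNzRingType) (r : seq A) : {pred A} := fun x =>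
  `[< exists h : nat -> A, x = \sum_(k < size r) h k * r`_k >].

Definition circ_ideal (F : fieldType) n (N : 'I_n -> nat) :
    {pred {mpoly F[n]}} :=
  ideal_gen [seq 'X_j ^+ N j - 1 | j <- enum 'I_n].
Arguments circ_ideal F [n] N.

Lemma circ_idealP (F : fieldType) n (N : 'I_n -> nat) (f : {mpoly F[n]}) :
  reflect (exists h : 'I_n -> {mpoly F[n]},
             f = \sum_(j < n) h j * ('X_j ^+ N j - 1))
          (f \in circ_ideal F N).
Proof.
have E h : \sum_(k < size [seq 'X_j ^+ N j - 1 : {mpoly F[n]} | j <- enum 'I_n])
     h (k : nat) * [seq 'X_j ^+ N j - 1 : {mpoly F[n]} | j <- enum 'I_n]`_k
   = \sum_(j < n) h j * ('X_j ^+ N j - 1).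
  rewrite size_map size_enum_ord; apply: eq_bigr => k _.
  by rewrite (nth_map k) ?size_enum_ord // nth_ord_enum.
apply: (iffP (asboolP _)) => -[h ->]; first by exists (fun j => h j).
pose h' k := if insub k is Some j then h j else 0.
exists h'; apply: etrans (esym (E h')).
by apply: eq_bigr => j _; rewrite /h' valK.
Qed.

Lemma circ_ideal_closed (F : fieldType) n (N : 'I_n -> nat) :
  idealr_closed (circ_ideal F N).
Proof.
split.
- by apply/circ_idealP; exists (fun=> 0); rewrite big1 // => j _; rewrite mul0r.
- apply/negP => /circ_idealP [h /(congr1 (fun f => f.@[fun=> 1]))].
  rewrite meval1 raddf_sum /= big1 => [/eqP|j _]; first by rewrite oner_eq0.
  by rewrite mevalM mevalB rmorphXn /= mevalXU expr1n meval1 subrr mulr0.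
- move=> a _ _ /circ_idealP [h ->] /circ_idealP [h' ->]; apply/circ_idealP.
  exists (fun j => a * h j + h' j); rewrite mulr_sumr -big_split /=.
  by apply: eq_bigr => j _; rewrite mulrDl mulrA.
Qed.

HB.instance Definition _ (F : fieldType) n (N : 'I_n -> nat) :=
  isIdealr.Build {mpoly F[n]} (circ_ideal F N) (circ_ideal_closed F N).

(* F[x_1, .., x_n] / <x_1 ^ N_1 - 1, .., x_n ^ N_n - 1> *)
Definition circ_ring (F : fieldType) n (N : 'I_n -> nat) :=
  {ideal_quot (circ_ideal F N)}.
Arguments circ_ring F [n] N.
HB.instance Definition _ (F : fieldType) n (N : 'I_n -> nat) :=
  GRing.ComNzRing.on (circ_ring F N).

Definition circ_pi (F : fieldType) n (N : 'I_n -> nat) (f : {mpoly F[n]}) :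
  circ_ring F N := \pi_(circ_ring F N) f.
Arguments circ_pi [F n] N f.

Lemma circ_pi_is_zmod (F : fieldType) n (N : 'I_n -> nat) :
  zmod_morphism (@circ_pi F n N).
Proof. exact: (rmorphB (\pi_{ideal_quot (circ_ideal F N)})). Qed.

Lemma circ_pi_is_monoid (F : fieldType) n (N : 'I_n -> nat) :
  monoid_morphism (@circ_pi F n N).
Proof.
split; first exact: (rmorph1 (\pi_{ideal_quot (circ_ideal F N)})).
exact: (rmorphM (\pi_{ideal_quot (circ_ideal F N)})).
Qed.

HB.instance Definition _ (F : fieldType) n (N : 'I_n -> nat) :=
  GRing.isZmodMorphism.Build {mpoly F[n]} (circ_ring F N) (@circ_pi F n N)
    (@circ_pi_is_zmod F n N).
HB.instance Definition _ (F : fieldType) n (N : 'I_n -> nat) :=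
  GRing.isMonoidMorphism.Build {mpoly F[n]} (circ_ring F N) (@circ_pi F n N)
    (@circ_pi_is_monoid F n N).

Lemma circ_pi_surj (F : fieldType) n (N : 'I_n -> nat) (g : circ_ring F N) :
  exists f, circ_pi N f = g.
Proof. by exists (repr g); rewrite /circ_pi reprK. Qed.

Lemma circ_pi_eq (F : fieldType) n (N : 'I_n -> nat) (f f' : {mpoly F[n]}) :
  circ_pi N f = circ_pi N f' <-> f - f' \in circ_ideal F N.
Proof. by rewrite Quotient.idealrBE; split => /eqP. Qed.

Definition code (F : fieldType) n (N m : 'I_n -> nat) : {pred circ_ring F N} :=
  ideal_gen [:: circ_pi N (\prod_(j < n) ('X_j - 1) ^+ m j)].
Arguments code F [n] N m.

Section CoefficientVector.
Variables (F : fieldType) (n : nat) (N : 'I_n -> nat).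

Definition mono (i : box N) : 'X_{1..n} := [multinom (i j : nat) | j < n].

(* The representative with a given coefficient vector. *)
Definition poly_of_vec (u : 'rV[F]_#|{: box N}|) : {mpoly F[n]} :=
  \sum_k u 0 k *: 'X_[mono (tnth (lexbox N) k)].

(* The default value 0 is never used when all the N j are positive: every g  *)
(* then has exactly one such vector, by coefvecP below.                      *)
Definition coefvec (g : circ_ring F N) : 'rV[F]_#|{: box N}| :=
  if pselect (exists u, circ_pi N (poly_of_vec u) = g) is left ex
  then sval (cid ex) else 0.

Lemma lexbox_perm : perm_eq (lexbox N) (enum {: box N}).
Proof. by rewrite /= perm_sort. Qed.

Lemma poly_of_vec_is_linear : linear poly_of_vec.
Proof.
move=> a u v; rewrite /poly_of_vec scaler_sumr -big_split /=.
by apply: eq_bigr => k _; rewrite !mxE scalerDl scalerA.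
Qed.

Let same (i : box N) (m : 'X_{1..n}) := [forall j, (m j == i j %[mod N j])%N].

Let phi (i : box N) K (f : {mpoly F[n]}) : F :=
  \sum_(m : 'X_{1..n < K} | same i m) f@_m.

Let phi_linear i K a f g : phi i K (a *: f + g) = a * phi i K f + phi i K g.
Proof.
rewrite /phi mulr_sumr -big_split /=.
by apply: eq_bigr => m _; rewrite mcoeffD mcoeffZ.
Qed.

Let phi0 i K : phi i K 0 = 0.
Proof. by rewrite /phi big1 // => m _; rewrite mcoeff0. Qed.

Let phi_sum i K (I : Type) (r : seq I) (c : I -> F) (f : I -> {mpoly F[n]}) :
  phi i K (\sum_(x <- r) c x *: f x) = \sum_(x <- r) c x * phi i K (f x).
Proof.
elim: r => [|x r IH]; first by rewrite !big_nil phi0.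
by rewrite !big_cons phi_linear IH.
Qed.

Let phiX i K m : (mdeg m < K)%N -> phi i K 'X_[m] = (same i m)%:R.
Proof.
move=> mK; rewrite /phi; case: (boolP (same i m)) => im.
  rewrite (bigD1 (BMultinom mK)) //= mcoeffX eqxx big1 ?addr0 // => m' /andP[_ m'm].
  by rewrite mcoeffX -[m]/(bmnm (BMultinom mK)) (inj_eq val_inj) eq_sym (negPf m'm).
rewrite big1 // => m' im'; rewrite mcoeffX; case: eqP => // E.
by rewrite E im' in im.
Qed.

Let phi_ideal i (h : 'I_n -> {mpoly F[n]}) :
  exists K0, forall K, (K0 <= K)%N ->
    phi i K (\sum_(j < n) h j * ('X_j ^+ N j - 1)) = 0.
Proof.
pose d j := (msize (h j) + N j)%N.
exists (\max_j d j)%N => K /bigmax_leqP hK.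
under eq_bigr => j _ do rewrite -[_ * _]scale1r.
rewrite phi_sum big1 // => j _; rewrite mul1r.
rewrite {1}[h j]mpolyE mulr_suml.
under eq_big_seq => m _ do rewrite -scalerAl.
rewrite phi_sum big1_seq // => m /= mh.
have mK : (mdeg (m + U_(j) *+ N j)%MM < K)%N.
  rewrite mdegD mdegMn mdeg1 mul1n; apply: leq_trans (hK j isT).
  by rewrite /d -addSn leq_add2r msize_mdeg_lt.
rewrite mulrBr mulr1 mpolyXn -mpolyXD addrC -scaleN1r phi_linear !phiX //; last first.
  by apply: leq_ltn_trans mK; rewrite mdegD leq_addr.
suff -> : same i (m + U_(j) *+ N j)%MM = same i m by rewrite mulN1r addNr mulr0.
apply: eq_forallb => k; rewrite mnmDE mulmnE mnm1E.
by case: (j =P k) => [->|_]; rewrite ?mul0n ?addn0 // mul1n modnDr.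
Qed.

Let same_mono i i' : same i (mono i') = (i == i').
Proof.
apply/forallP/eqP => [h|-> j]; last by rewrite mnmE.
apply/ffunP => j; apply/val_inj => /=.
by have /eqP := h j; rewrite mnmE !modn_small // => ->.
Qed.

Lemma poly_of_vec_inj (u v : 'rV[F]_#|{: box N}|) :
  circ_pi N (poly_of_vec u) = circ_pi N (poly_of_vec v) ->
  u = v.
Proof.
move/circ_pi_eq => /circ_idealP [h].
rewrite addrC -scaleN1r -poly_of_vec_is_linear scaleN1r addrC => E.
apply/eqP; rewrite -subr_eq0; apply/eqP; move: (u - v) E => w E.
apply/rowP => k; rewrite [RHS]mxE.
pose i := tnth (lexbox N) k; have [K0 hK] := phi_ideal i h.
pose K := maxn K0 (\max_l (mdeg (mono (tnth (lexbox N) l))).+1).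
have := hK K (leq_maxl _ _); rewrite -E /poly_of_vec phi_sum (bigD1 k) //=.
have dK l : (mdeg (mono (tnth (lexbox N) l)) < K)%N.
  rewrite leq_max (@leq_bigmax _ (fun l => (mdeg (mono (tnth (lexbox N) l))).+1)).
  by rewrite orbT.
rewrite phiX // same_mono eqxx mulr1 big1 ?addr0 // => l lk.
rewrite phiX // same_mono /i.
have /tuple_uniqP lexbox_inj : uniq (lexbox N).
  by rewrite (perm_uniq lexbox_perm) enum_uniq.
rewrite (inj_eq lexbox_inj) eq_sym (negPf lk) mulr0n mulr0 //.
Qed.

Lemma poly_of_vec_surj (N_gt0 : forall j, (0 < N j)%N) (g : circ_ring F N) :
  exists u, circ_pi N (poly_of_vec u) = g.
Proof.
have [f <-] := circ_pi_surj g.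
elim/mpolyind: f => [|c m f _ _ [u Eu]].
  exists 0; congr (circ_pi N); rewrite /poly_of_vec big1 // => k _.
  by rewrite mxE scale0r.
pose i : box N := [ffun j => Ordinal (ltn_pmod (m j) (N_gt0 j))].
have /tnthP [k Ek] : i \in lexbox N.
  by rewrite (perm_mem lexbox_perm) mem_enum.
exists (c *: delta_mx 0 k + u); rewrite poly_of_vec_is_linear.
rewrite !rmorphD /= Eu; congr (_ + _).
rewrite -!mul_mpolyC !rmorphM /=; congr (_ * _).
have -> : poly_of_vec (delta_mx 0 k) = 'X_[mono i].
  rewrite /poly_of_vec (bigD1 k) //= mxE !eqxx scale1r -Ek big1 ?addr0 // => l lk.
  by rewrite mxE (negPf lk) andbF scale0r.
rewrite !mpolyXE_id !rmorph_prod /=.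
apply: eq_bigr => j _; rewrite mnmE ffunE /= {2}(divn_eq (m j) (N j)).
rewrite exprD mulnC exprM rmorphM rmorphXn /=.
suff -> : @circ_pi F n N ('X_j ^+ N j) = 1 by rewrite expr1n mul1r.
apply: etrans (rmorph1 (@circ_pi F n N)); apply/circ_pi_eq.
apply/circ_idealP; exists (fun l => (l == j)%:R).
rewrite (bigD1 j) //= eqxx mul1r big1 ?addr0 // => l lj.
by rewrite (negPf lj) mul0r.
Qed.

Lemma coefvecP (N_gt0 : forall j, (0 < N j)%N) (g : circ_ring F N) u :
  coefvec g = u <-> circ_pi N (poly_of_vec u) = g.
Proof.
have E : circ_pi N (poly_of_vec (coefvec g)) = g.
  rewrite /coefvec; case: pselect => [ex|[]]; first by case: (cid ex).
  exact: poly_of_vec_surj.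
by split=> [<- //|Eu]; apply: poly_of_vec_inj; rewrite E Eu.
Qed.

End CoefficientVector.

Definition parity_check_matrix (F : fieldType) n (N : 'I_n -> nat) r
    (H : 'M[F]_(r, #|{: box N}|)) (C : {pred circ_ring F N}) : Prop :=
  forall g : circ_ring F N, g \in C <-> H *m (coefvec g)^T = 0.

(* The row index set is a finite set of n-tuples of naturals; since m l may   *)
(* exceed N l, it is carved out of the box of sides max (m j) (N j), which     *)
(* contains it.                                                               *)
Definition rowbox n (N m : 'I_n -> nat) := box (fun j => maxn (m j) (N j)).

Definition rowset n (N m : 'I_n -> nat) : {set rowbox N m} :=
  \bigcup_(l < n) [set a : rowbox N m |
     (a l < m l)%N && [forall j : 'I_n, (j != l) ==> (a j < N j)%N]].

Definition binom_row (F : fieldType) n (N m : 'I_n -> nat) (a : rowbox N m) :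
    'rV[F]_#|{: box N}| :=
  \row_k (\prod_(j < n) 'C(tnth (lexbox N) k j, a j))%N%:R.
Arguments binom_row F [n N m] a.

(* The rows are in the (arbitrary) enumeration order of rowset. *)
Definition check_matrix (F : fieldType) n (N m : 'I_n -> nat) :
    'M[F]_(#|rowset N m|, #|{: box N}|) :=
  \matrix_(r < #|rowset N m|) binom_row F (enum_val r).
Arguments check_matrix F [n] N m.

(* Main.v *)
Require Import Defs.
From HB Require Import structures.
From mathcomp Require Import all_boot all_order all_algebra.
From mathcomp Require Import boolp.
From mathcomp Require Import mpoly.

Set Implicit Arguments.
Unset Strict Implicit.
Unset Printing Implicit Defensive.

Import GRing.Theory.
Local Open Scope ring_scope.

(* After the substitution x_j -> y_j + 1 the quotient becomes
   F[y] / <y_j ^ N_j>, because (y_j + 1) ^ N_j - 1 = y_j ^ N_j when N_j is a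
   power of the characteristic, and the code becomes the monomial ideal
   generated by y_1 ^ m_1 .. y_n ^ m_n. The coefficient of y^a in f(y + 1) is
   \sum_i f_i \prod_j 'C(i_j, a_j), i.e. one entry of the syndrome; a vanishing
   syndrome thus says that f(y + 1), reduced modulo the y_j ^ N_j, only has
   monomials in that ideal. *)

Section Translate.
Variables (R : comNzRingType) (n : nat).
Implicit Types (c : R) (f h : {mpoly R[n]}) (a i : 'X_{1..n}).

Definition translate c : {mpoly R[n]} -> {mpoly R[n]} :=
  comp_mpoly [tuple 'X_j + c%:MP | j < n].

HB.instance Definition _ c := GRing.LRMorphism.on (translate c).

Lemma translateXU c j : translate c 'X_j = 'X_j + c%:MP.
Proof. by rewrite /translate comp_mpolyXU -tnth_nth tnth_mktuple. Qed.

Lemma translateX c a :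
  translate c 'X_[a] = \prod_(j < n) ('X_j + c%:MP) ^+ a j.
Proof.
by rewrite /translate comp_mpolyX; apply: eq_bigr => j _; rewrite tnth_mktuple.
Qed.

Lemma translateK c : cancel (translate c) (translate (- c)).
Proof.
move=> f; rewrite [in LHS](mpolyE f) [in RHS](mpolyE f).
rewrite (linear_sum (translate c)) (linear_sum (translate (- c))) /=.
apply: eq_bigr => a _; rewrite !linearZ /= translateX rmorph_prod /= mpolyXE_id.
congr (_ *: _); apply: eq_bigr => j _.
rewrite rmorphXn rmorphD /= translateXU /translate comp_mpolyC mpolyCN.
by rewrite subrK.
Qed.

(** Each factor [('X_j + 1) ^+ i j] expands by the binomial theorem. Once the product is distributed
    over these sums, every exponent tuple arises from exactly one choice of terms, so a single
    summand contributes at [a]. *)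
Lemma mcoeff_translate1X i a :
  (translate 1 'X_[i])@_a = (\prod_(j < n) 'C(i j, a j))%N%:R.
Proof.
(* One strict bound for both [i] and [a]: all binomial sums then range over the same ['I_K], as
   distributivity requires, and [a] is itself one of the choice functions, even where it exceeds
   [i]. *)
pose K := (\max_j maxn (i j) (a j)).+1.
have iK j : (i j < K)%N.
  by rewrite ltnS (leq_trans (leq_maxl _ (a j))) // leq_bigmax.
have aK j : (a j < K)%N.
  by rewrite ltnS (leq_trans (leq_maxr (i j) _)) // leq_bigmax.
have binom j : ('X_j + 1%:MP) ^+ i j =
    \sum_(k < K) 'X_j ^+ k *+ 'C(i j, k) :> {mpoly R[n]}.
  rewrite addrC exprDn (big_ord_widen_cond K xpredT
    (fun k => 1%:MP ^+ (i j - k) * 'X_j ^+ k *+ 'C(i j, k))) //.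
  rewrite big_mkcond; apply: eq_bigr => k _.
  by rewrite mpolyC1 expr1n mul1r ltnS; case: leqP => // /bin_small ->.
rewrite translateX (eq_bigr _ (fun j _ => binom j)) bigA_distr_bigA /=.
rewrite raddf_sum.
pose fa := [ffun j => Ordinal (aK j)].
have term (f : {ffun 'I_n -> 'I_K}) :
    (\prod_j ('X_j ^+ f j *+ 'C(i j, f j)) : {mpoly R[n]})@_a =
    (f == fa)%:R * (\prod_(j < n) 'C(i j, f j))%N%:R.
  have -> : \prod_j ('X_j ^+ f j *+ 'C(i j, f j)) =
      (\prod_(j < n) 'C(i j, f j))%N%:R *:
      'X_[[multinom (f j : nat) | j < n]] :> {mpoly R[n]}.
    rewrite mpolyXE_id natr_prod.
    rewrite -[RHS]mul_mpolyC rmorph_prod -big_split /=.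
    by apply: eq_bigr => j _; rewrite mnmE mul_mpolyC scaler_nat.
  rewrite mcoeffZ mcoeffX mulrC.
  suff -> : ([multinom (f j : nat) | j < n] == a) = (f == fa) by [].
  apply/eqP/eqP => [E|->]; last by apply/mnmP => j; rewrite mnmE ffunE.
  by apply/ffunP => j; apply/val_inj; rewrite ffunE /= -E mnmE.
rewrite (bigD1 fa) //= term eqxx mul1r [X in _ + X]big1 ?addr0 => [|f ffa].
  by congr (_ *+ _); apply: eq_bigr => j _; rewrite ffunE.
by rewrite term (negPf ffa) mul0r.
Qed.

Lemma mcoeffMX_eq0 h i a : ~~ (i <= a)%MM -> (h * 'X_[i])@_a = 0.
Proof.
move=> nia; apply/eqP; rewrite mcoeff_eq0 (perm_mem (msuppMX _ _)).
apply: contra nia => /mapP[k _ ->].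
by apply/mnm_lepP => j; rewrite mnmDE leq_addr.
Qed.

End Translate.

Lemma codeP (F : fieldType) n (N m : 'I_n -> nat) (g : circ_ring F N) :
  reflect (exists h, g = h * circ_pi N (\prod_(j < n) ('X_j - 1) ^+ m j))
          (g \in code F N m).
Proof.
apply: (iffP (asboolP _)) => [[h ->]|[h ->]].
  by exists (h 0%N); rewrite big_ord1.
by exists (fun=> h); rewrite big_ord1.
Qed.

Section CodeClosed.
Variables (F : fieldType) (n : nat) (N m : 'I_n -> nat).

Lemma code0 : 0 \in code F N m.
Proof. by apply/codeP; exists 0; rewrite mul0r. Qed.

Lemma codeD : {in code F N m &, forall x y, x + y \in code F N m}.
Proof.
move=> _ _ /codeP[h ->] /codeP[k ->]; apply/codeP; exists (h + k).
by rewrite mulrDl.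
Qed.

Lemma codeMl x : {in code F N m, forall y, x * y \in code F N m}.
Proof.
by move=> _ /codeP[h ->]; apply/codeP; exists (x * h); rewrite mulrA.
Qed.

End CodeClosed.

Section PrimePower.
Variables (p : nat) (F : fieldType) (n : nat) (s m : 'I_n -> nat).
Hypothesis charF : p \in [pchar F].
Let N := fun j : 'I_n => (p ^ s j)%N.
Implicit Types (f : {mpoly F[n]}) (a : 'X_{1..n}).

Lemma exprDn_pow_pchar (x y : {mpoly F[n]}) k :
  (x + y) ^+ (p ^ k) = x ^+ (p ^ k) + y ^+ (p ^ k).
Proof.
have charP : p \in [pchar {mpoly F[n]}].
  exact: (rmorph_pchar (@mpolyC n F) charF).
apply: exprDn_pchar; rewrite (eq_pnat _ (pcharf_eq charP)) pnatX.
by rewrite pnat_id ?(pcharf_prime charF).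
Qed.

Lemma translate1_Xn_sub1 j :
  translate (1 : F) ('X_j ^+ N j - 1 : {mpoly F[n]}) = 'X_j ^+ N j.
Proof.
rewrite rmorphB rmorphXn rmorph1 /= translateXU exprDn_pow_pchar.
by rewrite mpolyC1 expr1n addrK.
Qed.

Lemma circ_pi_XB1_pow j : circ_pi N (('X_j - 1) ^+ N j) = 0 :> circ_ring F N.
Proof.
have E : ('X_j - 1) ^+ N j = 'X_j ^+ N j - 1 :> {mpoly F[n]}.
  (* Both sides translate to ['X_j ^+ N j]. Comparing them there avoids computing a power of -1,
     which would need a case split on the parity of [p]. *)
  apply: (can_inj (translateK (1 : F))); rewrite translate1_Xn_sub1 rmorphXn /=.
  by rewrite rmorphB rmorph1 /= translateXU mpolyC1 addrK.
rewrite E; apply: etrans (rmorph0 (@circ_pi F n N)); apply/circ_pi_eq.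
rewrite subr0; apply/circ_idealP; exists (fun l => (l == j)%:R).
rewrite (bigD1 j) //= eqxx mul1r big1 ?addr0 // => l lj.
by rewrite (negPf lj) mul0r.
Qed.

(** A polynomial lies in a monomial ideal exactly when its coefficients at all monomials outside the
    ideal vanish. The exponents [a] quantified over here are those of the monomials divisible
    neither by any ['X_j ^+ N j] nor by the translated generator. *)
Lemma code_mcoeff f :
  reflect (forall a, (forall j, (a j < N j)%N) ->
             (exists l, (a l < m l)%N) -> (translate 1 f)@_a = 0)
          (circ_pi N f \in code F N m).
Proof.
apply: (iffP idP) => [/codeP[h0]|f0].
  have [h <-] := circ_pi_surj h0; rewrite -rmorphM /=.
  move=> /circ_pi_eq/circ_idealP[k E] a aN [l al].
  (* [f] becomes an element of the circulant ideal plus a multiple of the generator. After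
     translation each summand is a multiple of a monomial that does not divide the one at [a]. *)
  rewrite -[f](subrK (h * \prod_(j < n) ('X_j - 1) ^+ m j)) E.
  rewrite rmorphD rmorph_sum mcoeffD raddf_sum big1 => [|j _] /=.
    rewrite rmorphM rmorph_prod /= (eq_bigr (fun j => 'X_j ^+ m j)) => [|j _].
      have -> : \prod_(j < n) 'X_j ^+ m j =
          'X_[[multinom m j | j < n]] :> {mpoly F[n]}.
        by rewrite mpolyXE_id; apply: eq_bigr => j _; rewrite mnmE.
      rewrite add0r mcoeffMX_eq0 //; apply/negP => /mnm_lepP/(_ l).
      by rewrite mnmE leqNgt al.
    by rewrite rmorphXn rmorphB rmorph1 /= translateXU mpolyC1 addrK.
  rewrite rmorphM /= translate1_Xn_sub1 mpolyXn mcoeffMX_eq0 //.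
  apply/negP => /mnm_lepP/(_ j).
  by rewrite mulmnE mnm1E eqxx mul1n leqNgt aN.
(* Conversely, translating back the monomials of [translate 1 f] writes [f] as a combination of
   products of powers of the ['X_j - 1], and membership can be checked term by term. *)
rewrite -(translateK 1 f) [translate 1 f]mpolyE.
rewrite (rmorph_sum (translate (- 1))) (rmorph_sum (circ_pi N)) /=.
apply: (big_ind (fun x => x \in code F N m)) => [||a _].
- exact: code0.
- by move=> x y; apply: codeD.
rewrite -mul_mpolyC !rmorphM /=.
(* Either the generator divides the term, or the coefficient is zero by assumption, or some
   [('X_j - 1) ^+ N j] divides the term and kills it in the quotient. *)
case: (boolP [forall j, m j <= a j]%N) => [/forallP ma|/forallPn[l]].
  apply/codeMl/codeP; exists (circ_pi N (\prod_j ('X_j - 1) ^+ (a j - m j))).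
  rewrite -rmorphM /= translateX -big_split /=; congr circ_pi.
  by apply: eq_bigr => j _; rewrite mpolyCN mpolyC1 -exprD subnK.
rewrite -ltnNge => al.
case: (boolP [forall j, a j < N j]%N) => [/forallP aN|/forallPn[j]].
  rewrite f0 //; last by exists l.
  by rewrite mpolyC0 !rmorph0 mul0r; apply: code0.
rewrite -leqNgt => Na; apply: codeMl.
rewrite translateX (bigD1 j) //= mpolyCN mpolyC1 -(subnK Na) exprD !rmorphM /=.
by rewrite circ_pi_XB1_pow mulr0 mul0r; apply: code0.
Qed.

End PrimePower.

Lemma mcoeff_translate1_poly_of_vec (F : fieldType) n (N : 'I_n -> nat)
    (u : 'rV[F]_#|{: box N}|) (a : 'X_{1..n}) :
  (translate 1 (poly_of_vec u))@_a =
  \sum_k (\prod_(j < n) 'C(tnth (lexbox N) k j, a j))%N%:R * u 0 k.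
Proof.
rewrite /poly_of_vec (linear_sum (translate 1)) raddf_sum /=.
apply: eq_bigr => k _; rewrite !linearZ /= mcoeff_translate1X mulrC.
congr (_ * _); congr (_ *+ _).
by apply: eq_bigr => j _; rewrite mnmE.
Qed.

Theorem mainTheorem7 (p : nat) (F : finFieldType) (n : nat)
    (s m : 'I_n -> nat) (p_prime : prime p) (charF : p \in [pchar F])
    (n_gt0 : (0 < n)%N) (s_gt0 : forall j, (0 < s j)%N) :
  let N := fun j : 'I_n => (p ^ s j)%N in
  parity_check_matrix (check_matrix F N m) (code F N m).
Proof.
move=> N g.
have N_gt0 j : (0 < N j)%N by rewrite expn_gt0 prime_gt0.
(* Through [coefvecP] this trivial equality says that the coefficient vector of [g] does represent
   [g], so it is not the default value. *)
have /(coefvecP N_gt0) Eg : coefvec g = coefvec g by [].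
set u := coefvec g in Eg *; rewrite -Eg.
have entry r : (check_matrix F N m *m u^T) r 0 =
    (translate 1 (poly_of_vec u))@_[multinom (enum_val r j : nat) | j < n].
  rewrite mcoeff_translate1_poly_of_vec mxE; apply: eq_bigr => k _.
  rewrite !mxE; congr (_ * _); congr (_ *+ _).
  by apply: eq_bigr => j _; rewrite mnmE.
split=> [/(code_mcoeff s m charF) u0|u0].
  apply/colP => r; rewrite [RHS]mxE.
  have /bigcupP[l _] := enum_valP r; rewrite inE => /andP[al _].
  have [/forallP aN|/forallPn[j]] := boolP [forall j, enum_val r j < N j]%N.
    by rewrite entry u0 => [//|j|]; [|exists l]; rewrite mnmE.
  (* m l may exceed N l; the binomials of such a row all vanish. *)
  rewrite -leqNgt => Na; rewrite mxE big1 // => k _.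
  rewrite !mxE (bigD1 j) //= bin_small ?mul0n ?mul0r //.
  exact: leq_trans (ltn_ord _) Na.
apply/(code_mcoeff s m charF) => a aN [l al].
(* The exponent [a] is recast as a row index, so that its coefficient is the entry of the zero
   syndrome at the rank of [b]. *)
pose b : rowbox N m :=
  [ffun j => Ordinal (leq_trans (aN j) (leq_maxr (m j) _))].
have bQ : b \in rowset N m.
  apply/bigcupP; exists l => //; rewrite inE ffunE al /=.
  by apply/forallP => j; rewrite ffunE aN implybT.
have := entry (enum_rank_in bQ b); rewrite u0 [LHS]mxE enum_rankK_in // => ->.
by congr (_@_ _); apply/mnmP => j; rewrite mnmE ffunE.
Qed.
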